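(* (i) The functions $\omega$ and $\bar\omega$ are subadditive on $\mathbb{R}_-=(-\infty,0]$; and (ii) the functions $\chi$ and $\bar\chi$, where $\chi(\delta)=\omega(-\delta)$ and $\bar\chi(\delta)=\bar\omega(-\delta)$ for $\delta\ge 0$, are subadditive on $\mathbb{R}_+=[0,\infty)$.
   Context: Let $\epsilon\ge 0$ be real, $\tau\ge 1$ an integer, $(b_i)_{i\ge 1}$ a sequence of reals with $b_i\ge 0$ and $b_i\ge b_{i+1}$ for all $i\ge 1$, and $(v_i)_{i\ge 0}$ a sequence of reals with $b_{i+2}+v_{i+1}\ge b_{i+1}+v_i$ for all $i\ge 0$. Put $a_i=b_i+\tau\epsilon$ for $i\ge 1$, $A_0=0$, $A_i=\sum_{j=1}^i a_j$ and $B_i=A_{i-1}+b_i$ for $i\ge 1$. Let $g:\mathbb{R}\to\mathbb{R}$ be concave and set $\psi_i=g(-b_{i+1}-v_i-\epsilon)-g(-b_{i+1}-v_i)$ for $i\ge 0$. The continuous piecewise concave function $\omega:\mathbb{R}_-\to\mathbb{R}$ is defined recursively by $$\omega(\delta)=\begin{cases}0,&\delta=0,\\ g(\delta+A_i-v_i)+\omega(-A_i)-g(-v_i),&-B_{i+1}\le\delta<-A_i,\ i=0,1,\dots,\\ g(\delta+A_i+\ell\epsilon-v_i)+\omega(-A_i)+\ell\psi_i-g(-v_i),&-B_{i+1}-(\ell+1)\epsilon\le\delta<-B_{i+1}-\ell\epsilon,\ i=0,1,\dots,\ \ell=0,\dots,\tau-1.\end{cases}$$ Given an integer $m\ge 1$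 and $\gamma\in\{0,\dots,\tau-1\}$, the continuous piecewise concave function $\bar\omega:\mathbb{R}_-\to\mathbb{R}$ is defined by $$\bar\omega(\delta)=\begin{cases}\omega(\delta),&-B_m-(\gamma+1)\epsilon\le\delta\le 0,\\ g(\delta+A_{m-1}+\gamma\epsilon-v_{m-1})+\omega(-A_{m-1})+\gamma\psi_{m-1}-g(-v_{m-1}),&\delta<-B_m-(\gamma+1)\epsilon.\end{cases}$$ A function $q$ is subadditive on $D$ if $q(\delta_1)+q(\delta_2)\ge q(\delta_1+\delta_2)$ for all $\delta_1,\delta_2\in D$ with $\delta_1+\delta_2\in D$.
   Formalization: If ε=0 and the sum of the b_i is finite, the recursion leaves ω undefined on part of (−∞,0]; subadditivity of ω (and χ) is therefore stated on the set where the recursion defines ω (its reflection), which is all of (−∞,0] (resp. [0,∞)) whenever A_i is unbounded, e.g. if ε>0. *)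

(* Defs.v *)
From mathcomp Require Import all_boot all_order all_algebra.
From mathcomp Require Import all_classical all_reals all_analysis.
From mathcomp Require Import ring lra.

Set Implicit Arguments.
Unset Strict Implicit.
Unset Printing Implicit Defensive.
Import Order.TTheory GRing.Theory Num.Theory.
Local Open Scope classical_set_scope.
Local Open Scope ring_scope.

Definition nonpos {R : realType} : set R := [set d | d <= 0].
Definition nonneg {R : realType} : set R := [set d | 0 <= d].

Definition concave {R : realType} (g : R -> R) : Prop :=
  @convex_function R R^o setT (fun x => - g x).

Definition subadditive_on {R : realType} (D : set R) (q : R -> R) : Prop :=
  forall d1 d2, D d1 -> D d2 -> D (d1 + d2) -> q (d1 + d2) <= q d1 + q d2.

(* Sequences (b_i), (a_i), (B_i) start at i = 1; their value at 0 is never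
   used. *)
Definition aseq {R : realType} (eps : R) (tau : nat) (b : nat -> R) (i : nat) : R :=
  b i + tau%:R * eps.

Definition Aseq {R : realType} (eps : R) (tau : nat) (b : nat -> R) (i : nat) : R :=
  \sum_(1 <= j < i.+1) aseq eps tau b j.

Definition Bseq {R : realType} (eps : R) (tau : nat) (b : nat -> R) (i : nat) : R :=
  Aseq eps tau b i.-1 + b i.

Definition psi {R : realType} (eps : R) (b v : nat -> R) (g : R -> R) (i : nat) : R :=
  g (- b i.+1 - v i - eps) - g (- b i.+1 - v i).

Definition piece1 {R : realType} (eps : R) (tau : nat) (b : nat -> R)
    (i : nat) : set R :=
  [set d | - Bseq eps tau b i.+1 <= d < - Aseq eps tau b i].

Definition piece2 {R : realType} (eps : R) (tau : nat) (b : nat -> R)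
    (i l : nat) : set R :=
  [set d | - Bseq eps tau b i.+1 - l.+1%:R * eps <= d
           < - Bseq eps tau b i.+1 - l%:R * eps].

(* The recursive equations defining omega.  They determine omega on
   [omega_dom] and do not constrain it elsewhere ([omega_rec_exists],
   [omega_rec_unique]). *)
Definition omega_rec {R : realType} (eps : R) (tau : nat) (b v : nat -> R)
    (g omega : R -> R) : Prop :=
  [/\ omega 0 = 0,
      forall (i : nat) (d : R), piece1 eps tau b i d ->
        omega d = g (d + Aseq eps tau b i - v i)
                  + omega (- Aseq eps tau b i) - g (- v i)
    & forall (i l : nat) (d : R), (l < tau)%N -> piece2 eps tau b i l d ->
        omega d = g (d + Aseq eps tau b i + l%:R * eps - v i)
                  + omega (- Aseq eps tau b i)
                  + l%:R * psi eps b v g i - g (- v i)].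

(* The points to which one of the cases of the recursive definition applies.
   This is all of ]-oo, 0] exactly when (A_i) is unbounded
   ([omega_dom_nonposP]), in particular whenever 0 < eps.  If eps = 0 and
   (b_i) is summable, the recursion leaves omega undefined to the left of
   - lim A_i. *)
Definition omega_dom {R : realType} (eps : R) (tau : nat) (b : nat -> R) : set R :=
  [set d | [\/ d = 0,
               exists i, piece1 eps tau b i d
             | exists i l, (l < tau)%N /\ piece2 eps tau b i l d]].

Definition omegabar {R : realType} (eps : R) (tau : nat) (b v : nat -> R)
    (g omega : R -> R) (m gam : nat) (d : R) : R :=
  if - Bseq eps tau b m - gam.+1%:R * eps <= d then omega d
  else g (d + Aseq eps tau b m.-1 + gam%:R * eps - v m.-1)
       + omega (- Aseq eps tau b m.-1)
       + gam%:R * psi eps b v g m.-1 - g (- v m.-1).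

Section WellPosedness.
Context {R : realType} (eps : R) (tau : nat) (b v : nat -> R) (g : R -> R).
Context (eps_ge0 : 0 <= eps) (tau_gt0 : (1 <= tau)%N).
Context (b_ge0 : forall i, (1 <= i)%N -> 0 <= b i).

Local Notation A := (Aseq eps tau b).
Local Notation B := (Bseq eps tau b).
Local Notation psi := (psi eps b v g).
Local Notation piece1 := (piece1 eps tau b).
Local Notation piece2 := (piece2 eps tau b).
Local Notation dom := (omega_dom eps tau b).
Local Notation omega_rec := (omega_rec eps tau b v g).

Lemma Aseq0 : A 0%N = 0.
Proof. by rewrite /Aseq big_geq. Qed.

Lemma AseqS i : A i.+1 = A i + b i.+1 + tau%:R * eps.
Proof. by rewrite /Aseq big_nat_recr//= /aseq addrA. Qed.

Lemma BseqS i : B i.+1 = A i + b i.+1.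
Proof. by []. Qed.

Lemma Aseq_homo : {homo A : i j / (i <= j)%N >-> i <= j}.
Proof.
apply: (homo_leq (@lexx _ _) (fun y x z => @le_trans _ _ y x z)) => i.
by rewrite AseqS -addrA lerDl addr_ge0 ?b_ge0 ?mulr_ge0.
Qed.

Lemma piece1_sub i d : piece1 i d -> - A i.+1 <= d < - A i.
Proof.
rewrite /Defs.piece1 /= => /andP[h ->]; rewrite andbT (le_trans _ h)//.
by rewrite lerN2 AseqS BseqS lerDl mulr_ge0.
Qed.

Lemma piece2_sub i l d : (l < tau)%N -> piece2 i l d -> - A i.+1 <= d < - A i.
Proof.
move=> lt; rewrite /Defs.piece2 /= => /andP[h1 h2]; apply/andP; split.
  apply: le_trans h1; rewrite -opprD lerN2 AseqS BseqS lerD2l.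
  by rewrite ler_wpM2r// ler_nat.
apply: lt_le_trans h2 _; rewrite -opprD lerN2 BseqS -addrA lerDl.
by rewrite addr_ge0 ?b_ge0 ?mulr_ge0.
Qed.

Lemma piece2_cover i d : - A i.+1 <= d < - B i.+1 ->
  exists l, (l < tau)%N /\ piece2 i l d.
Proof.
move=> /andP[h1 h2]; rewrite AseqS -BseqS in h1.
have ex : exists n, - B i.+1 - n%:R * eps <= d by exists tau; lra.
case: (ex_minnP ex) => -[|l] hl lmin; first by move: h2; rewrite ltNge; lra.
exists l; split; first by apply: lmin; lra.
by rewrite /Defs.piece2 /= hl /= ltNge; apply/negP => /lmin; rewrite ltnn.
Qed.

Lemma pieces_cover i d : - A i.+1 <= d < - A i ->
  piece1 i d \/ exists l, (l < tau)%N /\ piece2 i l d.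
Proof.
move=> /andP[h1 h2]; have [h|h] := leP (- B i.+1) d.
  by left; rewrite /Defs.piece1 /= h.
by right; apply: piece2_cover; rewrite h1.
Qed.

Lemma layer_inj i j d :
  - A i.+1 <= d < - A i -> - A j.+1 <= d < - A j -> i = j.
Proof.
move=> /andP[i1 i2] /andP[j1 j2].
have [/Aseq_homo h|/Aseq_homo h|//] := ltngtP i j; exfalso; lra.
Qed.

Lemma piece2_inj i l k d : piece2 i l d -> piece2 i k d -> l = k.
Proof.
rewrite /Defs.piece2 /= => /andP[i1 i2] /andP[j1 j2].
have [lk|lk|//] := ltngtP l k.
- have : l.+1%:R * eps <= k%:R * eps by rewrite ler_wpM2r// ler_nat.
  move=> ?; exfalso; lra.
- have : k.+1%:R * eps <= l%:R * eps by rewrite ler_wpM2r// ler_nat.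
  move=> ?; exfalso; lra.
Qed.

Lemma piece12 i l d : piece1 i d -> piece2 i l d -> False.
Proof.
rewrite /Defs.piece1 /Defs.piece2 /= => /andP[i1 _] /andP[_ j2].
have ? : 0 <= l%:R * eps by rewrite mulr_ge0.
lra.
Qed.

Lemma omega_dom_nonposP :
  dom = nonpos <-> forall x : R, exists i, x <= A i.
Proof.
split=> [domE x|unb].
  have [x0|x0] := leP x 0; first by exists 0%N; rewrite Aseq0.
  have : dom (- x) by rewrite domE /nonpos /=; lra.
  case=> [|[i /piece1_sub]|[i [l [lt /(piece2_sub lt)]]]]; first lra.
    by exists i.+1; lra.
  by exists i.+1; lra.
apply/seteqP; split => d; rewrite /nonpos /=.
  have A_ge0 i : 0 <= A i by rewrite -Aseq0 Aseq_homo.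
  by case=> [->//|[i /piece1_sub]|[i [l [lt /(piece2_sub lt)]]]];
    have := A_ge0 i; lra.
rewrite le_eqVlt => /orP[/eqP ->|d0]; first by constructor 1.
have ex : exists i, - d <= A i by exact: unb.
case: (ex_minnP ex) => -[|i] hi imin; first by move: hi; rewrite Aseq0; lra.
have hlt : A i < - d by rewrite ltNge; apply/negP => /imin; rewrite ltnn.
have /pieces_cover[h|h] : - A i.+1 <= d < - A i by apply/andP; split; lra.
  by constructor 2; exists i.
by constructor 3; exists i.
Qed.

Lemma omega_dom_eps_gt0 : 0 < eps -> dom = nonpos.
Proof.
move=> e0; apply/omega_dom_nonposP => x.
have AiE i : i%:R * eps <= A i.
  elim: i => [|i IH]; first by rewrite Aseq0 mul0r.
  have : 1 * eps <= tau%:R * eps by rewrite ler_wpM2r// ler1n.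
  have := b_ge0 (ltn0Sn i); rewrite AseqS -natr1; lra.
exists (Num.truncn (`|x| / eps)).+1; apply: le_trans (AiE _).
rewrite -ler_pdivrMr//; apply: le_trans (ltW (truncnS_gt _)).
by rewrite ler_pM2r ?invr_gt0// ler_norm.
Qed.

Fixpoint omegaA (i : nat) : R :=
  if i is j.+1 then
    g (- b j.+1 - v j) + tau%:R * psi j + omegaA j - g (- v j)
  else 0.

Lemma omega_rec_A omega i : omega_rec omega -> omega (- A i) = omegaA i.
Proof.
move=> [w0 w1 w2]; elim: i => [|i IH] /=; first by rewrite Aseq0 oppr0.
have [e0|e0] := eqVneq eps 0.
  have psi0 : psi i = 0 by rewrite /Defs.psi e0 subr0 subrr.
  have AiS : A i.+1 = A i + b i.+1 by rewrite AseqS [X in _ * X]e0 mulr0 addr0.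
  have [bi0|bi0] := eqVneq (b i.+1) 0.
    by rewrite AiS bi0 addr0 IH psi0 mulr0 addr0 oppr0 sub0r addrAC subrr add0r.
  rewrite (w1 i); last first.
    rewrite /Defs.piece1 /= BseqS AiS lexx /=.
    by rewrite ltrN2 ltrDl lt_neqAle eq_sym bi0 b_ge0.
  rewrite IH psi0 AiS mulr0 addr0.
  by congr (g _ + _ - _); ring.
have tE : tau%:R = tau.-1%:R + 1 :> R by rewrite natr1 prednK.
have ep : 0 < eps by rewrite lt_neqAle eq_sym e0.
rewrite (w2 i tau.-1) ?prednK//; last first.
  rewrite /Defs.piece2 /= prednK// BseqS AseqS tE; apply/andP; split; lra.
rewrite IH AseqS tE.
have -> : - (A i + b i.+1 + (tau.-1%:R + 1) * eps) + A i + tau.-1%:R * eps - v i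
  = - b i.+1 - v i - eps by ring.
by rewrite /Defs.psi; ring.
Qed.

Lemma omega_rec_unique omega1 omega2 :
  omega_rec omega1 -> omega_rec omega2 -> {in dom, omega1 =1 omega2}.
Proof.
move=> r1 r2 d /set_mem; have A1 i := omega_rec_A i r1.
have A2 i := omega_rec_A i r2.
case: r1 r2 => [w0 w1 w2] [w0' w1' w2'].
case=> [->|[i h]|[i [l [lt h]]]]; first by rewrite w0 w0'.
  by rewrite (w1 _ _ h) (w1' _ _ h) A1 A2.
by rewrite (w2 _ _ _ lt h) (w2' _ _ _ lt h) A1 A2.
Qed.

Lemma omega_rec_exists : exists omega, omega_rec omega.
Proof.
pose P d y := [\/ d = 0 /\ y = 0,
  exists i, piece1 i d /\ y = g (d + A i - v i) + omegaA i - g (- v i)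
| exists i l, [/\ (l < tau)%N, piece2 i l d &
   y = g (d + A i + l%:R * eps - v i) + omegaA i + l%:R * psi i - g (- v i)]].
have Pfun d y z : P d y -> P d z -> y = z.
  have A_ge0 i : 0 <= A i by rewrite -Aseq0 Aseq_homo.
  case=> [[d0 ->]|[i [h ->]]|[i [l [lt h ->]]]].
  - case=> [[_ ->]//|[i [/piece1_sub]]|[i [l [lt /(piece2_sub lt)]]]];
      have := A_ge0 i; lra.
  - case=> [[d0 _]|[j [k ->]]|[j [l [lt k _]]]].
    + have := piece1_sub h; have := A_ge0 i; lra.
    + by rewrite (layer_inj (piece1_sub h) (piece1_sub k)).
    + have ij := layer_inj (piece1_sub h) (piece2_sub lt k).
      by rewrite -ij in k; case: (piece12 h k).
  - case=> [[d0 _]|[j [k ->]]|[j [l' [lt' k ->]]]].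
    + have := piece2_sub lt h; have := A_ge0 i; lra.
    + have ij := layer_inj (piece2_sub lt h) (piece1_sub k).
      by rewrite -ij in k; case: (piece12 k h).
    + have ij := layer_inj (piece2_sub lt h) (piece2_sub lt' k).
      by rewrite -ij in k *; rewrite (piece2_inj h k).
pose w d := xget 0 (P d).
have wE d y : P d y -> w d = y.
  by move=> h; exact: Pfun (xgetI 0 h) h.
have wA i : w (- A i) = omegaA i.
  elim: i => [|i IH]; first by apply: wE; constructor 1; rewrite Aseq0 oppr0.
  have [e0|e0] := eqVneq eps 0.
    have psi0 : psi i = 0 by rewrite /Defs.psi e0 subr0 subrr.
    have AiS : A i.+1 = A i + b i.+1 by rewrite AseqS [X in _ * X]e0 mulr0 addr0.
    have [bi0|bi0] := eqVneq (b i.+1) 0.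
      by rewrite /= AiS bi0 addr0 IH psi0 mulr0 addr0 oppr0 sub0r addrAC subrr add0r.
    apply: wE; constructor 2; exists i; split.
      rewrite /Defs.piece1 /= BseqS AiS lexx /=.
      by rewrite ltrN2 ltrDl lt_neqAle eq_sym bi0 b_ge0.
    rewrite /= psi0 AiS mulr0 addr0.
    by congr (g _ + _ - _); ring.
  have tE : tau%:R = tau.-1%:R + 1 :> R by rewrite natr1 prednK.
  have ep : 0 < eps by rewrite lt_neqAle eq_sym e0.
  apply: wE; constructor 3; exists i, tau.-1; split; first by rewrite prednK.
    rewrite /Defs.piece2 /= prednK// BseqS AseqS tE; apply/andP; split; lra.
  rewrite /= AseqS tE.
  have -> : - (A i + b i.+1 + (tau.-1%:R + 1) * eps) + A i + tau.-1%:R * eps - v i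
    = - b i.+1 - v i - eps by ring.
  by rewrite /Defs.psi; ring.
exists w; split=> [|i d h|i l d lt h].
- by apply: wE; constructor 1.
- by rewrite wA; apply: wE; constructor 2; exists i.
- by rewrite wA; apply: wE; constructor 3; exists i, l.
Qed.

End WellPosedness.

(* Main.v *)
Require Import Defs.
From mathcomp Require Import all_boot all_order all_algebra.
From mathcomp Require Import all_classical all_reals all_analysis.
From mathcomp Require Import ring lra zify.

Set Implicit Arguments.
Unset Strict Implicit.
Unset Printing Implicit Defensive.
Import Order.TTheory GRing.Theory Num.Theory.
Local Open Scope classical_set_scope.
Local Open Scope ring_scope.

(** With [x = - delta] and [G y = g (- y)], the slope of [chi] runs through a
sawtooth of values of [G']: once over [v_i, b_(i+1) + v_i], then [tau] times
over [b_(i+1) + v_i, b_(i+1) + v_i + eps], for [i = 0, 1, ...].  The inequality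
[chi (x + y) <= chi x + chi y] is a finite linear inequality between values of
[G] that is tight for affine [G], so it is enough to prove it for the hinges
[G = min (., t)].  There [chi x] is the length of the part of [[0, x]] where the
sawtooth is below [t].  Let [S_n] and [H_n] be the lengths, below and above [t],
of the first [n] teeth.  Then [chi x <= max (S_n, x - H_n)] for every [n], with
equality for a suitable [n], while [S] is subadditive and [H], after a change in
the layers lying entirely above [t], superadditive on the suitable indices.

The function [omegabar] prolongs one tooth to infinity, and [omega] coincides
with [omegabar] on bounded sets for large [m]. *)

(** * Concave functions tested at finitely many points *)

Section Concave.
Context {R : realType}.
Implicit Types (g : R -> R) (s : seq R).

(** Clearing the denominators keeps the degenerate case [x = z]. *)
Lemma concave_chord g x y z : concave g -> x <= y -> y <= z ->
  (z - y) * g x + (y - x) * g z <= (z - x) * g y.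
Proof.
move=> cg xy yz; have [zx|zx] := leP z x.
  have [-> ->] : x = y /\ z = y by split; lra.
  by rewrite subrr !mul0r addr0.
have h0 : 0 <= (y - x) / (z - x) by apply: divr_ge0; lra.
have h1 : (y - x) / (z - x) <= 1 by rewrite ler_pdivrMr//; lra.
pose p : {i01 R} := Itv01 h0 h1.
have : - g (p%:num * z + (1 - p%:num) * x) <= p%:num * - g z + (1 - p%:num) * - g x.
  exact: (cg p z x (in_setT _) (in_setT _)).
rewrite /=.
have zx0 : z - x != 0 by rewrite gt_eqF; lra.
have -> : (y - x) / (z - x) * z + (1 - (y - x) / (z - x)) * x = y by field.
rewrite -(ler_pM2l (_ : 0 < z - x)); last lra.
have -> : (z - x) * ((y - x) / (z - x) * - g z + (1 - (y - x) / (z - x)) * - g x)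
  = - ((z - y) * g x + (y - x) * g z) by field.
lra.
Qed.

Lemma concaveN g : concave g -> concave (fun y => g (- y)).
Proof.
move=> cg p x y _ _.
have : - g (p%:num * - x + (1 - p%:num) * - y) <= p%:num * - g (- x) + (1 - p%:num) * - g (- y).
  exact: (cg p (- x) (- y) (in_setT _) (in_setT _)).
have -> : p%:num * - x + (1 - p%:num) * - y = - (p%:num * x + (1 - p%:num) * y) by ring.
exact.
Qed.

Definition kinked (G : R -> R) p c r := fun y =>
  G p + c * (y - p) + \sum_(k <- r) k.1 * (Num.min y k.2 - y) : R.

(** Induction along the sorted points. At [p] the slope drops from the upper slope [c] to the chord
    slope [c'] towards the next point; the drop, nonnegative by concavity, is the weight of a kink
    at [p]. Terms with later kinks vanish at [p]. *)
Lemma concave_kinked G s p c : concave G -> sorted <=%R (p :: s) ->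
  (forall y, p <= y -> G y <= G p + c * (y - p)) ->
  exists r : seq (R * R), all (fun k => (0 <= k.1) && (p <= k.2)) r /\
    {in p :: s, G =1 kinked G p c r}.
Proof.
move=> cG; elim: s p c => [|p' s IH] p c.
  move=> _ _; exists [::]; split=> // y; rewrite inE => /eqP ->.
  by rewrite /kinked big_nil subrr mulr0 !addr0.
rewrite /= => /andP[pp' ps] Gle.
have [epp'|npp'] := eqVneq p p'.
  subst p'; have [r [r0 rE]] := IH p c ps Gle.
  by exists r; split=> // y; rewrite inE => /predU1P[->|]; apply: rE; rewrite ?mem_head.
have lpp' : 0 < p' - p by rewrite subr_gt0 lt_neqAle npp'.
pose c' := (G p' - G p) / (p' - p).
have c'E : G p' = G p + c' * (p' - p) by rewrite /c'; field; rewrite gt_eqF.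
have c'c : c' <= c by rewrite /c' ler_pdivrMr//; have := Gle _ pp'; lra.
(* Beyond [p'] a concave function stays below the prolonged chord, so [c'] is an upper slope
   there. *)
have Gle' y : p' <= y -> G y <= G p' + c' * (y - p').
  move=> p'y; have := concave_chord cG pp' p'y.
  have e : (p' - p) * c' = G p' - G p by rewrite c'E; ring.
  by move=> h; rewrite -(ler_pM2l lpp') mulrDr mulrA e; lra.
have [r [/allP r0 rE]] := IH p' c' ps Gle'.
exists ((c - c', p) :: r); split=> [|y].
  rewrite /= lexx subr_ge0 c'c /=; apply/allP => k /r0 /andP[-> h] /=.
  exact: le_trans pp' h.
rewrite inE => /predU1P[->|ys].
  rewrite /kinked big_seq big1 ?subrr ?mulr0 ?addr0// => k.
  rewrite inE => /predU1P[->|/r0 /andP[_ pk]] /=; first by rewrite minxx subrr mulr0.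
  by rewrite min_l ?(le_trans pp' pk)// subrr mulr0.
have p'y : p' <= y.
  move: ys; rewrite inE => /predU1P[->//|ys].
  by move: ps; rewrite (path_sortedE (@le_trans _ R)) => /andP[/allP/(_ _ ys)].
rewrite rE// /kinked big_cons /= min_r ?(le_trans pp')// c'E.
ring.
Qed.

(* Between the finitely many points that a finite linear functional sees, a
   concave function is a line plus nonnegative multiples of [min y t - y]. *)
Lemma concave_functional_ge0 G (L : seq (R * R)) :
  let ev h := \sum_(k <- L) k.1 * h k.2 : R in
  ev (fun=> 1) = 0 -> ev id = 0 ->
  (forall t, 0 <= ev (fun y => Num.min y t)) ->
  concave G -> 0 <= ev G.
Proof.
move=> ev ev1 evid evmin cG.
pose s := sort <=%R [seq k.2 | k <- L].
have memL k : k \in L -> k.2 \in s by move=> kL; rewrite mem_sort map_f.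
have ss : sorted <=%R s by exact: (sort_sorted (@le_total _ R)).
case: s ss memL => [|p s] ss memL.
  rewrite /ev big_seq big1// => k /memL; by rewrite in_nil.
(* The chord over [[p - 1, p]] supplies an initial upper slope at [p]. *)
have Gle y : p <= y -> G y <= G p + (G p - G (p - 1)) * (y - p).
  move=> py; have := @concave_chord G (p - 1) p y cG.
  move=> /(_ ltac:(lra) py); lra.
have [r [/allP r0 rE]] := concave_kinked cG ss Gle.
have -> : ev G = ev (kinked G p (G p - G (p - 1)) r).
  by rewrite /ev !big_seq; apply: eq_bigr => k /memL /rE ->.
set c := G p - _.
have -> : ev (kinked G p c r) = (G p - c * p) * ev (fun=> 1) + c * ev id
   + \sum_(k <- r) k.1 * (ev (fun y => Num.min y k.2) - ev id).
  rewrite /ev !mulr_sumr.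
  under [X in _ = _ + _ + X]eq_bigr do rewrite -sumrB mulr_sumr.
  rewrite exchange_big -!big_split /=; apply: eq_bigr => k _.
  rewrite /kinked mulrDr mulr_sumr; congr (_ + _); first ring.
  by apply: eq_bigr => i _; ring.
rewrite ev1 evid !mulr0 !add0r big_seq sumr_ge0// => k /r0 /andP[k0 _].
by rewrite subr0 mulr_ge0.
Qed.

(** The list of weighted points stays existential: closure lemmas then build it for [branch], which
    contains sums of variable length. *)
Definition finite_functional (F : (R -> R) -> R) :=
  exists L : seq (R * R), forall h, F h = \sum_(k <- L) k.1 * h k.2.

Lemma finite_functional_eval p : finite_functional (@^~ p).
Proof. by exists [:: (1, p)] => h; rewrite big_seq1 mul1r. Qed.

Lemma finite_functionalD F1 F2 : finite_functional F1 -> finite_functional F2 ->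
  finite_functional (fun h => F1 h + F2 h).
Proof. by move=> [L1 E1] [L2 E2]; exists (L1 ++ L2) => h; rewrite big_cat E1 E2. Qed.

Lemma finite_functionalN F : finite_functional F ->
  finite_functional (fun h => - F h).
Proof.
move=> [L E]; exists [seq (- k.1, k.2) | k <- L] => h.
by rewrite E big_map -sumrN; apply: eq_bigr => k _; rewrite mulNr.
Qed.

Lemma finite_functional_sum n (F : 'I_n -> (R -> R) -> R) :
  (forall i, finite_functional (F i)) ->
  finite_functional (fun h => \sum_(i < n) F i h).
Proof.
move=> /choice[L E]; exists (flatten [seq L i | i <- index_enum 'I_n]) => h.
by rewrite big_flatten big_map; apply: eq_bigr.
Qed.

Lemma finite_functional_concave_ge0 F G : finite_functional F ->
  F (fun=> 1) = 0 -> F id = 0 -> (forall t, 0 <= F (fun y => Num.min y t)) ->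
  concave G -> 0 <= F G.
Proof.
move=> [L FE] F1 Fid Fmin cG; rewrite FE; apply: concave_functional_ge0 => //.
- by have := FE (fun=> 1); rewrite F1 => /esym.
- by have := FE id; rewrite Fid => /esym.
- by move=> t; have := FE (fun y => Num.min y t); have := Fmin t => /[swap] <-.
Qed.
End Concave.

(** * Division rounded up *)

Section Multiples.
Local Open Scope nat_scope.
(* The number of multiples of [tau] in [[0, n)], that is n / tau rounded up. *)
Definition nmultiples tau n := (n + tau.-1) %/ tau.
Context (tau : nat) (tau_gt0 : 0 < tau).
Local Notation q := (nmultiples tau).

(** The Galois connection of ceiling division, from which subadditivity follows. *)
Lemma nmultiples_leq n k : (q n <= k) = (n <= k * tau).
Proof. by rewrite -ltnS ltn_divLR// mulSn; lia. Qed.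

Lemma nmultiplesMD i n : q (i * tau + n) = i + q n.
Proof. by rewrite /nmultiples -addnA divnMDl. Qed.

Lemma nmultiples_small l : l <= tau -> q l = (0 < l).
Proof.
case: l => [|l] lt; first by rewrite /nmultiples add0n divn_small ?prednK.
apply/eqP; rewrite eqn_leq nmultiples_leq mul1n lt /=.
by rewrite ltnNge nmultiples_leq mul0n.
Qed.

Lemma nmultiplesM i : q (i * tau) = i.
Proof. by rewrite -(addn0 (i * tau)) nmultiplesMD nmultiples_small ?addn0. Qed.

Lemma nmultiplesD n m : q (n + m) <= q n + q m.
Proof.
by rewrite nmultiples_leq mulnDl leq_add// -nmultiples_leq.
Qed.

Lemma nmultiplesDl n m : tau %| n -> q (n + m) = q n + q m.
Proof. by move=> /dvdnP[i ->]; rewrite nmultiplesMD nmultiplesM. Qed.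

Lemma nmultiplesS n : q n.+1 = q n + (tau %| n).
Proof.
rewrite {1 2}(divn_eq n tau) -addnS !nmultiplesMD -addnA; congr (_ + _).
have lt : n %% tau < tau by rewrite ltn_mod.
rewrite !nmultiples_small ?(ltnW lt)// /dvdn.
by case: (n %% tau).
Qed.

Lemma leq_nmultiples n m : n <= m -> q n <= q m.
Proof. by move=> nm; rewrite leq_div2r ?leq_add2r. Qed.
End Multiples.

(** * Sums over teeth grouped into layers *)

Section PrefixSums.
Context {R : realType}.
Implicit Types a p r : nat -> R.

Lemma prefix_sum_mono a n m : (forall i, 0 <= a i) -> (n <= m)%N ->
  \sum_(i < n) a i <= \sum_(i < m) a i.
Proof.
move=> a0 /subnKC <-; rewrite big_split_ord /= lerDl sumr_ge0// => i _; exact: a0.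
Qed.

Lemma prefix_sum_subadditive a n m : {homo a : i j / (i <= j)%N >-> j <= i} ->
  \sum_(i < n + m) a i <= \sum_(i < n) a i + \sum_(i < m) a i.
Proof.
move=> a_ni; rewrite big_split_ord /= lerD2l; apply: ler_sum => i _.
by apply: a_ni; rewrite leq_addl.
Qed.

Lemma prefix_sum_superadditive a n m : {homo a : i j / (i <= j)%N >-> i <= j} ->
  \sum_(i < n) a i + \sum_(i < m) a i <= \sum_(i < n + m) a i.
Proof.
move=> a_nd; rewrite big_split_ord /= lerD2l; apply: ler_sum => i _.
by apply: a_nd; rewrite leq_addl.
Qed.

Context (tau : nat) (tau_gt0 : (0 < tau)%N).
Local Notation q := (nmultiples tau).

(** The contributions [r] of layer openings are summed apart from those of the single teeth: [p] and
    [r] will each be monotone, while the interleaved sequence need not be. *)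
Definition layersum p r n : R :=
  \sum_(j < n) p (j %/ tau)%N + \sum_(i < q n) r i.

Lemma layersum0 p r : layersum p r 0 = 0.
Proof. by rewrite /layersum nmultiples_small// !big_ord0 addr0. Qed.

Lemma layersumS p r n : layersum p r n.+1 =
  layersum p r n + (p (n %/ tau)%N + if (tau %| n)%N then r (n %/ tau)%N else 0).
Proof.
rewrite /layersum big_ord_recr /= nmultiplesS//.
case: ifP => [dv|_]; last by rewrite addn0 addr0 addrAC.
rewrite addn1 big_ord_recr /=.
have -> : q n = (n %/ tau)%N by rewrite -{1}(divnK dv) nmultiplesM.
by ring.
Qed.

Lemma layersum_mono p r n m : (forall i, 0 <= p i) -> (forall i, 0 <= r i) ->
  (n <= m)%N -> layersum p r n <= layersum p r m.
Proof.
move=> p0 r0 nm; apply: lerD.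
  by apply: (@prefix_sum_mono (fun j => p (j %/ tau)%N)).
by apply: prefix_sum_mono => //; apply: leq_nmultiples.
Qed.

(** Splitting [n + m] teeth into two runs can only increase the number of openings, which costs
    nothing on the right when [r] is nonnegative. *)
Lemma layersum_subadditive p r n m :
  {homo p : i j / (i <= j)%N >-> j <= i} -> {homo r : i j / (i <= j)%N >-> j <= i} ->
  (forall i, 0 <= r i) ->
  layersum p r (n + m) <= layersum p r n + layersum p r m.
Proof.
move=> p_ni r_ni r0; rewrite /layersum addrACA; apply: lerD.
  apply: (@prefix_sum_subadditive (fun j => p (j %/ tau)%N)) => i j ij.
  by apply: p_ni; rewrite leq_div2r.
apply: le_trans (prefix_sum_subadditive _ _ r_ni).
by apply: prefix_sum_mono => //; apply: nmultiplesD.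
Qed.

(** Divisibility makes the numbers of openings add up exactly, so no opening is counted twice on the
    left. *)
Lemma layersum_superadditive p r n m :
  {homo p : i j / (i <= j)%N >-> i <= j} -> {homo r : i j / (i <= j)%N >-> i <= j} ->
  (tau %| n)%N || (tau %| m)%N ->
  layersum p r n + layersum p r m <= layersum p r (n + m).
Proof.
move=> p_nd r_nd dv; rewrite /layersum addrACA; apply: lerD.
  apply: (@prefix_sum_superadditive (fun j => p (j %/ tau)%N)) => i j ij.
  by apply: p_nd; rewrite leq_div2r.
apply: (le_trans (prefix_sum_superadditive _ _ r_nd)).
have -> : q (n + m) = (q n + q m)%N; last by [].
by case/orP: dv => dv; last rewrite addnC [RHS]addnC; apply: nmultiplesDl.
Qed.

End PrefixSums.

(** * The sawtooth and its primitive *)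

Section Sawtooth.
Context {R : realType} (eps : R) (tau : nat) (v w : nat -> R).
Context (eps_ge0 : 0 <= eps) (tau_gt0 : (0 < tau)%N).
Context (v_le_w : forall i, v i <= w i).
Context (v_nd : {homo v : i j / (i <= j)%N >-> i <= j}).
Context (w_nd : {homo w : i j / (i <= j)%N >-> i <= j}).
Context (wv_ni : {homo (fun i => w i - v i) : i j / (i <= j)%N >-> j <= i}).
Implicit Types (G : R -> R) (n k : nat) (x y t : R).

(* Teeth are numbered across layers: tooth [k] lies in layer [k %/ tau], ends at
   the value [w (k %/ tau) + eps], and is longer if it opens its layer.  In the
   application [w i] is b_(i+1) + v_i.  [height G k] is chi at the left end of
   tooth [k], and this left end itself is [height id k]. *)
Definition height G n := layersum tau
  (fun i => G (w i + eps) - G (w i)) (fun i => G (w i) - G (v i)) n.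

Definition start k := if (tau %| k)%N then v (k %/ tau)%N else w (k %/ tau)%N.

Local Notation X := (height id).

(** The formula for chi on tooth [k], taken at every [x] so that it also describes a prolonged
    tooth. *)
Definition branch G k x := height G k + (G (start k + (x - X k)) - G (start k)).

(* As in omegabar, the teeth after the [K]-th are dropped and the [K]-th is
   unbounded. *)
Definition reach K k x :=
  [&& (k <= K)%N, X k <= x & (x <= X k.+1) || (k == K)].

Lemma height0 G : height G 0 = 0.
Proof. exact: layersum0. Qed.

Lemma heightS G n :
  height G n.+1 = height G n + (G (w (n %/ tau)%N + eps) - G (start n)).
Proof.
rewrite /height layersumS// /start; case: ifP => _; last by rewrite addr0.
by congr (_ + _); ring.
Qed.

Lemma start_le k : start k <= w (k %/ tau)%N.
Proof. by rewrite /start; case: ifP. Qed.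

Lemma height_id_homo : {homo X : i j / (i <= j)%N >-> i <= j}.
Proof. by move=> i j; apply: layersum_mono => k; rewrite ?lerBrDr ?add0r /= ?lerDl. Qed.

Lemma reach_ge0 K k x : reach K k x -> 0 <= x.
Proof. by case/and3P=> _ + _; apply: le_trans; rewrite -(height0 id) height_id_homo. Qed.

(** * Hinges: lengths below and above the bend *)

Section Hinge.
Context (t : R).
Local Notation hinge := (fun y : R => Num.min y t).
Local Notation S := (height hinge).
Let H n := X n - S n.
(* Each layer's hole length capped only from below: this sequence is
   nondecreasing even past the layers that lie entirely above [t]. *)
Let Ht := layersum tau (fun i => eps - (hinge (w i + eps) - hinge (w i)))
                       (fun i => Num.max 0 (w i - t)).

Lemma hinge_homo : {homo hinge : x y / x <= y}.
Proof. by move=> x y xy /=; case: (leP x t); case: (leP y t) => *; lra. Qed.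

Lemma hinge_lip x y : x <= y -> hinge y - hinge x <= y - x.
Proof. by move=> xy /=; case: (leP x t); case: (leP y t) => *; lra. Qed.

Lemma height_hinge_homo : {homo S : i j / (i <= j)%N >-> i <= j}.
Proof.
by move=> i j; apply: layersum_mono => k; rewrite subr_ge0; apply: hinge_homo;
  rewrite ?lerDl.
Qed.

Lemma H_homo : {homo H : i j / (i <= j)%N >-> i <= j}.
Proof.
apply: (homo_leq (@lexx _ _) (fun y x z => @le_trans _ _ y x z)) => n.
rewrite /H !heightS.
have /hinge_lip : start n <= w (n %/ tau)%N + eps by rewrite (le_trans (start_le n))// lerDl.
by lra.
Qed.

(** Both increments of the hinge decrease with the layer: [[w i, w i + eps]] moves right, and
    [[v i, w i]] moves right and shrinks. *)
Lemma height_hinge_subadditive n m : S (n + m) <= S n + S m.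
Proof.
apply: layersum_subadditive => // [i j ij|i j ij|i].
- have := eps_ge0; have := w_nd ij => /=.
  by case: (leP (w i) t); case: (leP (w j) t);
     case: (leP (w i + eps) t); case: (leP (w j + eps) t) => *; lra.
- have := v_nd ij; have := wv_ni ij; have := v_le_w j; have := v_le_w i => /=.
  by case: (leP (w i) t); case: (leP (w j) t);
     case: (leP (v i) t); case: (leP (v j) t) => *; lra.
- by rewrite subr_ge0 hinge_homo.
Qed.

(** The indices on which [Ht] is superadditive: either the openings add up exactly, or the opening
    part of [Ht] vanishes. *)
Definition good n := (tau %| n)%N || (\sum_(i < nmultiples tau n) Num.max 0 (w i - t) == 0).

Lemma Ht_superadditive n m : good n -> good m -> Ht n + Ht m <= Ht (n + m).
Proof.
have p_nd : {homo (fun i => eps - (hinge (w i + eps) - hinge (w i))) :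
    i j / (i <= j)%N >-> i <= j}.
  move=> i j /w_nd /=; have := eps_ge0.
  by case: (leP (w i) t); case: (leP (w j) t);
     case: (leP (w i + eps) t); case: (leP (w j + eps) t) => *; lra.
have r_nd : {homo (fun i => Num.max 0 (w i - t)) : i j / (i <= j)%N >-> i <= j}.
  by move=> i j /w_nd; case: (leP 0 (w i - t)); case: (leP 0 (w j - t)) => *; lra.
rewrite /good => gn gm.
case: (boolP ((tau %| n)%N || (tau %| m)%N)); first exact: layersum_superadditive.
case/norP=> /negPf n1 /negPf m1; move: gn gm; rewrite n1 m1 /= => /eqP en /eqP em.
rewrite /Ht /layersum en em !addr0; apply: ler_wpDr.
  by rewrite sumr_ge0// => i _; rewrite le_max lexx.
apply: (@prefix_sum_superadditive _ (fun j => eps - (hinge (w (j %/ tau)%N + eps) - hinge (w (j %/ tau)%N)))) => i j ij.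
by apply: p_nd; rewrite leq_div2r.
Qed.

Lemma HE : H =1 layersum tau (fun i => eps - (hinge (w i + eps) - hinge (w i)))
   (fun i => (w i - v i) - (hinge (w i) - hinge (v i))).
Proof.
move=> n; rewrite /H /height /layersum opprD addrACA -!sumrB; congr (_ + _).
by apply: eq_bigr => i _ /=; ring.
Qed.

Lemma Ht_eq n : (forall i, (i < nmultiples tau n)%N -> v i <= t) -> Ht n = H n.
Proof.
move=> vt; rewrite HE /Ht /layersum; congr (_ + _); apply: eq_bigr => i _.
have := vt i (ltn_ord i); have := v_le_w i => /=.
by case: (leP 0 (w i - t)); case: (leP (v i) t); case: (leP (w i) t) => *; lra.
Qed.

(** From layer [i] on every tooth lies above [t], where the hinge is constant. *)
Lemma height_hinge_stationary i n : t < v i -> (i * tau <= n)%N -> S n = S (i * tau).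
Proof.
move=> tv /subnKC <-; elim: (n - _)%N => [|l IH]; first by rewrite addn0.
rewrite addnS heightS IH.
have iq : (i <= (i * tau + l) %/ tau)%N by rewrite divnMDl ?leq_addr.
have tw := lt_le_trans (lt_le_trans tv (v_nd iq)) (v_le_w _).
have ts : t < start (i * tau + l).
  by rewrite /start; case: ifP => // _; apply: lt_le_trans (v_nd iq).
by rewrite (min_r (ltW ts)) min_r ?subrr ?addr0// (le_trans (ltW tw))// lerDl.
Qed.

(* Past a layer that starts above [t] the heights no longer grow. *)
Lemma Ht_eq_or_max n : Ht n = H n \/ forall m, S m <= S n.
Proof.
have [[i [iq tv]]|h] := pselect (exists i, (i < nmultiples tau n)%N /\ t < v i).
  right=> m; have iqn : (i * tau <= n)%N.
    by rewrite leqNgt; apply/negP => /ltnW; rewrite -nmultiples_leq// leqNgt iq.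
  have [mn|nm] := leqP m n; first exact: height_hinge_homo.
  by rewrite (height_hinge_stationary tv iqn) (height_hinge_stationary tv) // (leq_trans iqn)// ltnW.
left; apply: Ht_eq => i iq; rewrite leNgt; apply/negP => tv; apply: h.
by exists i.
Qed.

Context (K : nat) (t_lt : t < w (K %/ tau)%N + eps).

(** The branch rises with slope 1 from [S k], which is [X k - H k], and saturates at [S k.+1]. On
    the unbounded tooth [K] the saturation value is still [S K.+1], because [t_lt] puts the bend
    before its regular end. *)
Lemma branch_hingeE k x : reach K k x ->
  branch hinge k x = Num.min (x - H k) (S k.+1).
Proof.
case/and3P=> kK Xx xX; rewrite /branch /H heightS.
have sw := start_le k; have e0 := eps_ge0.
have : x - X k <= w (k %/ tau)%N + eps - start k \/ t < w (k %/ tau)%N + eps.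
  case/orP: xX => [|/eqP ->]; last by right.
  by rewrite heightS => ?; left; lra.
move: (S k) (X k) Xx (start k) sw (w (k %/ tau)%N) => sk xk Xx st sw wk h.
case: (leP st t); case: (leP (wk + eps) t); case: (leP (st + _) t) => *;
 case: leP => *; case: h => h; lra.
Qed.

Lemma branch_hinge_le k x n : reach K k x ->
  branch hinge k x <= Num.max (S n) (x - Ht n).
Proof.
move=> /branch_hingeE ->; rewrite le_max; have [->|Smax] := Ht_eq_or_max n.
  have [nk|kn] := leqP n k.
    by rewrite orbC ge_min lerD2l lerN2 H_homo.
  by rewrite [X in X || _]ge_min (height_hinge_homo kn) orbT.
by rewrite [X in X || _]ge_min Smax orbT.
Qed.

(** Converse of [branch_hinge_le] at a suitable index. The second alternative covers points where
    the branch has reached its overall maximum and no good index need exist. *)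
Lemma branch_hinge_ge k x : reach K k x ->
  (exists2 n, good n & Num.max (S n) (x - Ht n) <= branch hinge k x) \/
  (forall k' x', reach K k' x' -> branch hinge k' x' <= branch hinge k x).
Proof.
move=> r; rewrite branch_hingeE//; case/and3P: (r) => kK Xx xX.
set i := (k %/ tau)%N.
have ik : (i * tau <= k)%N := leq_divM _ _.
have ki : (k < i.+1 * tau)%N by rewrite ltn_ceil.
have maxS k' x' : reach K k' x' -> branch hinge k' x' <= S k'.+1.
  by move=> /branch_hingeE ->; rewrite ge_min lexx orbT.
have Xk1 : X k.+1 - H k.+1 = S k.+1 by rewrite /H; ring.
have Xk : X k - H k = S k by rewrite /H; ring.
have SkSk1 : S k <= S k.+1 by rewrite height_hinge_homo.
have Skb : S k <= Num.min (x - H k) (S k.+1) by rewrite le_min SkSk1 andbT -Xk lerD2r.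
(* If layer [i] starts above [t], then [S] is constant from its first tooth on, and [S k] bounds
   every branch value. *)
have [tv|vt] := ltP t (v i).
  right=> k' x' /maxS h; apply: (le_trans h); apply: le_trans Skb.
  have [k'k|kk'] := ltnP k' k; first exact: height_hinge_homo.
  by rewrite (height_hinge_stationary tv) ?(leqW (leq_trans ik kk'))// (height_hinge_stationary tv ik).
have HtE n : (n <= i.+1 * tau)%N -> Ht n = H n.
  rewrite -nmultiples_leq// => ni; apply: Ht_eq => j jn.
  by apply: le_trans vt; apply: v_nd; rewrite -ltnS (leq_trans jn).
(* Past a regular end only tooth [K] is reachable; its value there is [S K.+1], the largest
   possible. *)
have [xX'|xX'] := leP x (X k.+1); last first.
  have kKe : k = K by case/orP: xX => [|/eqP//]; rewrite leNgt xX'.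
  right=> k' x' r'; have k'K : (k' <= K)%N by case/and3P: r'.
  apply: (le_trans (maxS _ _ r')); rewrite le_min kKe height_hinge_homo ?andbT//.
  rewrite -kKe; apply: (le_trans (y := S k.+1)); first by rewrite kKe height_hinge_homo.
  by have := H_homo (leqnSn k); lra.
(* If [w i <= t], no opening up to layer [i] extends beyond [t], so all indices up to the end of
   that layer are good; [k] or [k.+1] serves, according to the term attaining the minimum. *)
left; have [wt|tw] := leP (w i) t.
  have gd n : (n <= i.+1 * tau)%N -> good n.
    rewrite -nmultiples_leq// => ni; rewrite /good big1 ?eqxx ?orbT// => j _.
    rewrite max_l// subr_le0 (le_trans (w_nd _) wt)// -ltnS.
    exact: leq_trans (ltn_ord j) ni.
  have [h|h] := leP (x - H k) (S k.+1).
    exists k; first exact/gd/ltnW.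
    by rewrite HtE ?(ltnW ki)// ge_max lexx andbT -Xk lerD2r.
  exists k.+1; first exact: gd.
  by rewrite HtE// ge_max lexx -Xk1 lerD2r.
(* Now [v i <= t < w i]: only the opening tooth of layer [i] can have a part below [t]. *)
have Skend n : (i * tau < n)%N -> (n <= i.+1 * tau)%N -> S n = S (i * tau).+1.
  move=> + ni; move: (ni) => /[swap] /subnKC <-.
  elim: (n - _)%N => [|l IH] lt; first by rewrite addn0.
  rewrite addnS heightS IH; last by apply: ltnW; rewrite -addnS.
  have lt' : (l.+1 < tau)%N by move: lt; rewrite mulSn; lia.
  rewrite addSnnS /start divnMDl// (divn_small lt') addn0 dvdn_addr ?dvdn_mull//.
  rewrite gtnNdvd//.
  by rewrite !min_r ?subrr ?addr0 ?(ltW tw)// (le_trans (ltW tw))// lerDl.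
have Send : S k.+1 = S (i.+1 * tau).
  by rewrite (Skend k.+1)// (Skend (i.+1 * tau)%N)// ltn_pmul2r.
(* A saturated branch is matched at the end of the layer. Otherwise [S] grows along tooth [k], which
   must then open the layer. Both indices are multiples of [tau]. *)
have [h|h] := leP (S k.+1) (Num.min (x - H k) (S k.+1)).
  exists (i.+1 * tau)%N; first by rewrite /good dvdn_mull.
  rewrite HtE// ge_max -Send h /=; apply: le_trans h.
  rewrite Send; have := height_id_homo ki; rewrite /H; lra.
have ke : k = (i * tau)%N.
  apply/eqP; rewrite eqn_leq ik andbT leqNgt; apply/negP => ik'.
  by have := le_lt_trans Skb h; rewrite Send (Skend k)// ?(ltnW ki)// (Skend (i.+1 * tau)%N) ?ltxx// ltn_pmul2r.
exists k; first by rewrite /good {1}ke dvdn_mull.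
rewrite HtE ?(ltnW ki)// ge_max Skb /=.
by rewrite le_min lexx ltW//; move: h; rewrite gt_min ltxx orbF.
Qed.

(** If one value on the right is maximal, the other need only be nonnegative. Otherwise good [n] and
    [m] bound the two values from below, and [n + m] bounds the left side from above. *)
Lemma branch_hinge_subadditive_lt k1 k2 k3 x y :
  reach K k1 x -> reach K k2 y -> reach K k3 (x + y) ->
  branch hinge k3 (x + y) <= branch hinge k1 x + branch hinge k2 y.
Proof.
move=> r1 r2 r3.
have ge0 k z : reach K k z -> 0 <= branch hinge k z.
  move=> r; have := branch_hingeE r => ->; case/and3P: r => _ Xz _.
  rewrite le_min (_ : 0 <= height hinge k.+1); last first.
    by rewrite -(height0 hinge) height_hinge_homo.
  rewrite andbT /H opprB addrA [z + _]addrC -addrA addr_ge0 ?subr_ge0//.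
  by rewrite -(height0 hinge) height_hinge_homo.
have [[n gn hn]|mx] := branch_hinge_ge r1; last first.
  by have := mx _ _ r3; have := ge0 _ _ r2; lra.
have [[m gm hm]|mx] := branch_hinge_ge r2; last first.
  by have := mx _ _ r3; have := ge0 _ _ r1; lra.
apply: (le_trans (branch_hinge_le (n + m) r3)).
move: hn hm; rewrite !ge_max => /andP[n1 n2] /andP[m1 m2]; apply/andP; split.
  by have := height_hinge_subadditive n m; lra.
by have := Ht_superadditive gn gm; lra.
Qed.
End Hinge.

(** * Hinges that bend at or after the regular end of tooth [K] *)

Section HighHinge.
Context (t : R) (K : nat) (t_ge : w (K %/ tau)%N + eps <= t).
Local Notation hinge := (fun y : R => Num.min y t).

Lemma height_hinge_id n : (n <= K)%N -> height hinge n = X n.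
Proof.
elim: n => [|n IH] nK; first by rewrite !height0.
have wt : w (n %/ tau)%N + eps <= t.
  by apply: le_trans t_ge; rewrite lerD2r w_nd// leq_div2r// ltnW.
rewrite !heightS IH ?(ltnW nK)// !min_l//.
by apply: le_trans wt; rewrite (le_trans (start_le n))// lerDl.
Qed.

(** Up to the regular end of tooth [K] the hinge acts as the identity, so only the prolongation of
    that tooth feels the cap. *)
Lemma branch_hinge_id k x : reach K k x ->
  branch hinge k x = Num.min x (X K + (t - start K)).
Proof.
case/and3P=> kK Xx xX; rewrite /branch height_hinge_id//.
have wt j : (j <= K)%N -> w (j %/ tau)%N + eps <= t.
  by move=> jK; apply: le_trans t_ge; rewrite lerD2r w_nd// leq_div2r.
have st j : (j <= K)%N -> start j <= t.
  move=> jK; apply: (le_trans (start_le j)).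
  by have := wt j jK; have := eps_ge0; lra.
rewrite (min_l (st _ kK)); have := st _ kK; have := st _ (leqnn K).
have [-> _ _|nkK] := eqVneq k K.
  by case: leP => ?; case: leP => *; lra.
move: xX; rewrite (negPf nkK) orbF heightS => xX stK stk.
have XK : X k.+1 <= X K by rewrite height_id_homo// ltn_neqAle nkK.
move: XK; rewrite heightS => XK; have := wt _ kK => wtk.
by case: leP => ?; case: leP => *; lra.
Qed.

Lemma branch_hinge_subadditive_ge k1 k2 k3 x y :
  reach K k1 x -> reach K k2 y -> reach K k3 (x + y) ->
  branch hinge k3 (x + y) <= branch hinge k1 x + branch hinge k2 y.
Proof.
move=> r1 r2 r3; rewrite !branch_hinge_id//.
have x0 := reach_ge0 r1; have y0 := reach_ge0 r2.
have C0 : 0 <= X K + (t - start K).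
  rewrite addr_ge0 ?subr_ge0 -?(height0 id) ?height_id_homo//.
  by rewrite (le_trans (start_le K))// (le_trans _ t_ge)// lerDl.
move: (X K + _) C0 => C C0.
by case: (leP x C) => ?; case: (leP y C) => ?; case: (leP (x + y) C) => ?; lra.
Qed.
End HighHinge.

(** * From hinges to concave functions *)

Lemma finite_functional_branch k x : finite_functional (fun G => branch G k x).
Proof.
have ev p := @finite_functional_eval R p.
have evB a c : finite_functional (fun G : R -> R => G a - G c).
  by apply: finite_functionalD => //; apply: finite_functionalN.
apply: finite_functionalD; last exact: evB.
by apply: finite_functionalD; apply: finite_functional_sum => i; apply: evB.
Qed.

Lemma branch_id k x : branch id k x = x.
Proof. by rewrite /branch; ring. Qed.

Lemma branch_const k x : branch (fun=> 1) k x = 0.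
Proof.
by rewrite /branch /height /layersum !big1 ?subrr ?addr0// => i _; rewrite subrr.
Qed.

Lemma branch_subadditive G K k1 k2 k3 x y : concave G ->
  reach K k1 x -> reach K k2 y -> reach K k3 (x + y) ->
  branch G k3 (x + y) <= branch G k1 x + branch G k2 y.
Proof.
move=> cG r1 r2 r3; rewrite -subr_ge0.
apply: (@finite_functional_concave_ge0 _
  (fun G => branch G k1 x + branch G k2 y - branch G k3 (x + y))) => //.
- apply: finite_functionalD; last exact/finite_functionalN/finite_functional_branch.
  by apply: finite_functionalD; apply: finite_functional_branch.
- by rewrite !branch_const addr0 subrr.
- by rewrite !branch_id subrr.
- move=> t; rewrite subr_ge0.
  have [h|h] := leP (w (K %/ tau)%N + eps) t.
    exact: branch_hinge_subadditive_ge r1 r2 r3.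
  exact: branch_hinge_subadditive_lt r1 r2 r3.
Qed.
End Sawtooth.

(** * Identification of [omega] and [omegabar] with sawtooth branches *)

Section Omega.
Context {R : realType} (eps : R) (tau : nat) (b v : nat -> R) (g omega : R -> R).
Context (eps_ge0 : 0 <= eps) (tau_gt0 : (0 < tau)%N).
Context (b_ge0 : forall i, (1 <= i)%N -> 0 <= b i).
Context (omegaP : omega_rec eps tau b v g omega).

Local Notation A := (Aseq eps tau b).
Local Notation B := (Defs.Bseq eps tau b).
Local Notation psi := (psi eps b v g).
Local Notation w := (fun i => v i + b i.+1).
Local Notation G := (fun y => g (- y)).
Local Notation height := (height eps tau v w).
Local Notation branch := (branch eps tau v w).
Local Notation start := (start tau v w).
Local Notation reach := (reach eps tau v w).
Local Notation omegabar := (omegabar eps tau b v g omega).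

Lemma height_layer h i l : (l < tau)%N -> height h (i * tau + l.+1) =
  height h (i * tau) + (h (w i) - h (v i)) + l.+1%:R * (h (w i + eps) - h (w i)).
Proof.
elim: l => [|l IH] lt; rewrite addnS heightS// divnMDl// (divn_small _)// ?addn0.
  by rewrite /start dvdn_mull// mulnK//; ring.
rewrite IH ?(ltnW lt)// /start dvdn_addr ?dvdn_mull// gtnNdvd//.
rewrite divnMDl// (divn_small lt) addn0 -[l.+2%:R]natr1; ring.
Qed.

Lemma psiE i : psi i = G (w i + eps) - G (w i).
Proof. by congr (g _ - g _); ring. Qed.

Lemma height_id_mul i : height id (i * tau) = A i.
Proof.
elim: i => [|i IH]; first by rewrite height0// Aseq0.
rewrite (_ : i.+1 * tau = i * tau + tau.-1.+1)%N; last by rewrite prednK// mulSnr.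
rewrite height_layer ?prednK// IH AseqS /=; ring.
Qed.

Lemma height_id_layer i l : (l < tau)%N ->
  height id (i * tau + l.+1) = B i.+1 + l.+1%:R * eps.
Proof. by move=> lt; rewrite height_layer// height_id_mul Defs.BseqS /=; ring. Qed.

Lemma height_mul i : height G (i * tau) = omega (- A i).
Proof.
rewrite (omega_rec_A eps_ge0 tau_gt0 b_ge0 _ omegaP).
elim: i => [|i IH] /=; first by rewrite height0.
rewrite (_ : i.+1 * tau = i * tau + tau.-1.+1)%N; last by rewrite prednK// mulSnr.
rewrite height_layer ?prednK// IH psiE.
have -> : - b i.+1 - v i = - (v i + b i.+1) by ring.
by ring.
Qed.

Lemma branchE i l x : (l < tau)%N -> branch G (i * tau + l) x =
  g (- x + A i + l%:R * eps - v i) + omega (- A i) + l%:R * psi i - g (- v i).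
Proof.
rewrite -height_mul -height_id_mul psiE /branch.
case: l => [|l] lt; first rewrite addn0 /start dvdn_mull// mulnK//.
  rewrite !mul0r !addr0.
  have -> : - x + height id (i * tau) - v i = - (v i + (x - height id (i * tau))) by ring.
  by ring.
have lt' := ltnW lt.
rewrite !height_layer// /start dvdn_addr ?dvdn_mull// gtnNdvd//.
rewrite divnMDl// (divn_small lt) addn0 /=.
rewrite [X in _ + (g X - _)](_ : _ = - x + height id (i * tau) + l.+1%:R * eps - v i); last by ring.
by ring.
Qed.

Lemma omega_branch k x : height id k < x -> x <= height id k.+1 ->
  omega (- x) = branch G k x.
Proof.
have [_ w1 w2] := omegaP.
rewrite (divn_eq k tau); move: (k %/ tau)%N (ltn_pmod k tau_gt0) => i.
move: (k %% tau)%N => l lt.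
rewrite branchE// -addnS height_id_layer//.
case: l lt => [|l] lt; last first.
  rewrite height_id_layer ?(ltnW lt)// => x1 x2.
  by rewrite (w2 i l.+1)// /piece2 /=; lra.
rewrite addn0 height_id_mul => x1 x2; rewrite mul0r addr0 mul0r addr0.
(* The opening tooth covers both [piece1 i] and [piece2 i 0], on which the two formulas coincide. *)
have [xB|Bx] := leP x (B i.+1); first by rewrite (w1 i)// /piece1 /=; lra.
by rewrite (w2 i 0%N)// ?mul0r ?addr0// /piece2 /=; lra.
Qed.

Lemma omega_reach K x : 0 <= x -> x <= height id K.+1 ->
  exists2 k, reach K k x & omega (- x) = branch G k x.
Proof.
have [w0 _ _] := omegaP; have bw i : v i <= w i by rewrite lerDl b_ge0.
rewrite le_eqVlt => /predU1P[<- _|x0 xK].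
  exists 0%N; last by rewrite oppr0 w0 /branch !height0// subr0 addr0 subrr addr0.
  apply/and3P; rewrite height0//; split => //.
  by rewrite -(height0 eps v w tau_gt0 id) height_id_homo.
have ex : exists n, x <= height id n by exists K.+1.
(* Minimality gives the strict left bound required by [omega_branch], even among teeth of length
   zero. *)
case: (ex_minnP ex) => -[|k] xk kmin.
  by move: xk; rewrite height0// leNgt x0.
have kx : height id k < x by rewrite ltNge; apply/negP => /kmin; rewrite ltnn.
exists k; last exact: omega_branch.
by rewrite /reach -ltnS kmin//= (ltW kx) xk.
Qed.

(** The threshold of [omegabar] is minus the right end of tooth [i * tau + l], which thus plays the
    role of the unbounded tooth. *)
Lemma omegabar_reach i l x : (l < tau)%N -> 0 <= x ->
  exists2 k, reach (i * tau + l) k x & omegabar i.+1 l (- x) = branch G k x.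
Proof.
move=> lt x0; have XE : - B i.+1 - l.+1%:R * eps = - height id (i * tau + l).+1.
  by rewrite -addnS height_id_layer // [RHS]opprD.
rewrite /omegabar XE lerN2; case: leP => [|xX]; first exact: omega_reach.
exists (i * tau + l)%N; last by rewrite branchE.
rewrite /reach leqnn eqxx orbT andbT /= (le_trans _ (ltW xX))// height_id_homo// => j.
by rewrite lerDl b_ge0.
Qed.

Context (b_ni : forall i, (1 <= i)%N -> b i.+1 <= b i).
Context (bv : forall i, b i.+1 + v i <= b i.+2 + v i.+1).
Context (g_concave : concave g).

Lemma omegabar_subadditive i l : (l < tau)%N ->
  subadditive_on nonpos (omegabar i.+1 l).
Proof.
have homo_step (f : nat -> R) : (forall j, f j <= f j.+1) ->
    {homo f : i j / (i <= j)%N >-> i <= j}.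
  exact: (homo_leq (@lexx _ _) (fun y x z => @le_trans _ _ y x z)).
move=> lt d1 d2; rewrite /nonpos /= => d10 d20 d0.
have r d : d <= 0 ->
    exists2 k, reach (i * tau + l) k (- d) & omegabar i.+1 l d = branch G k (- d).
  by rewrite -oppr_ge0 => /(omegabar_reach i lt); rewrite opprK.
have [k1 r1 ->] := r _ d10; have [k2 r2 ->] := r _ d20; have [k3 + ->] := r _ d0.
rewrite opprD => r3; apply: branch_subadditive r1 r2 r3 => //.
- by move=> j; rewrite lerDl b_ge0.
(* [v] is nondecreasing because [b j.+1 + v j] is nondecreasing in [j] while [b j.+1] is
   nonincreasing. *)
- by apply: homo_step => j; have := b_ni (ltn0Sn j); have := bv j; lra.
- by apply: homo_step => j; have := bv j; lra.
- move=> j k jk; rewrite -lerN2.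
  apply: (@homo_step (fun j => - (v j + b j.+1 - v j))) jk => a.
  by have := b_ni (ltn0Sn a); lra.
- exact: concaveN.
Qed.

Lemma omegabarE m l d : (- B m <= d) -> omegabar m l d = omega d.
Proof.
move=> Bd; rewrite /omegabar ifT//; apply: le_trans Bd.
by rewrite gerDl oppr_le0 mulr_ge0.
Qed.

Lemma omega_dom_layer d : omega_dom eps tau b d ->
  d <= 0 /\ exists i, - A i <= d.
Proof.
have A_ge0 i : 0 <= A i by rewrite -(Aseq0 eps tau b) (Aseq_homo tau eps_ge0 b_ge0).
case=> [->|[i /(piece1_sub eps_ge0)]|[i [l [lt /(piece2_sub eps_ge0 b_ge0 lt)]]]].
- by split=> //; exists 0%N; rewrite Aseq0 oppr0.
- by case/andP=> h1 h2; split; [have := A_ge0 i; lra|exists i.+1].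
- by case/andP=> h1 h2; split; [have := A_ge0 i; lra|exists i.+1].
Qed.

Lemma omega_subadditive : subadditive_on (omega_dom eps tau b) omega.
Proof.
move=> d1 d2 /omega_dom_layer[d10 _] /omega_dom_layer[d20 _].
move=> /omega_dom_layer[d0 [i Ad]].
have bi := b_ge0 (ltn0Sn i).
(* Both [d1] and [d2] lie between [d1 + d2] and 0, so one [omegabar] agrees with [omega] at all
   three points. *)
rewrite -!(@omegabarE i.+1 0%N) ?Defs.BseqS; try lra.
exact: omegabar_subadditive.
Qed.
End Omega.

Lemma subadditive_on_opp {R : realType} (D : set R) (f : R -> R) :
  subadditive_on D f -> subadditive_on [set d | D (- d)] (fun d => f (- d)).
Proof. by move=> sf d1 d2 /= D1 D2; rewrite opprD => D12; apply: sf. Qed.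

Unset Implicit Arguments.

Theorem theorem4p21 (R : realType) (eps : R) (tau : nat) (b v : nat -> R)
    (g omega : R -> R)
    (eps_ge0 : 0 <= eps) (tau_ge1 : (1 <= tau)%N)
    (b_ge0 : forall i : nat, (1 <= i)%N -> 0 <= b i)
    (b_noninc : forall i : nat, (1 <= i)%N -> b i >= b i.+1)
    (bv : forall i : nat, b i.+2 + v i.+1 >= b i.+1 + v i)
    (g_concave : concave g)
    (omegaP : omega_rec eps tau b v g omega) :
  let dom := omega_dom eps tau b in
  let omegabar := omegabar eps tau b v g omega in
  let chi := fun d : R => omega (- d) in
  let chibar := fun (m gam : nat) (d : R) => omegabar m gam (- d) in
  (subadditive_on dom omega /\
   forall m gam : nat, (1 <= m)%N -> (gam < tau)%N ->
     subadditive_on nonpos (omegabar m gam)) /\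
  (subadditive_on [set d | dom (- d)] chi /\
   forall m gam : nat, (1 <= m)%N -> (gam < tau)%N ->
     subadditive_on nonneg (chibar m gam)).
Proof.
have sub := omega_subadditive eps_ge0 tau_ge1 b_ge0 omegaP b_noninc bv g_concave.
have subbar m gam : (1 <= m)%N -> (gam < tau)%N ->
    subadditive_on nonpos (omegabar eps tau b v g omega m gam).
  case: m => // m _.
  exact: omegabar_subadditive eps_ge0 tau_ge1 b_ge0 omegaP b_noninc bv g_concave m gam.
split; split=> //; first exact: subadditive_on_opp.
move=> m gam m1 lt; have := subadditive_on_opp (subbar m gam m1 lt).
rewrite (_ : [set d | nonpos (- d)] = nonneg)//.
by apply/seteqP; split=> d; rewrite /nonpos /nonneg /= oppr_le0.
Qed.
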